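(* Consider the asynchronous multi-agent system with switching topology and time-varying delays in which, for every $i\in\{1,\dots,n\}$ and $k\in\mathbb{Z}_+$, for $t\in[t_k^i,t_{k+1}^i)$, $$\dot x_i(t)=\begin{cases}\displaystyle\sum_{j\in\mathcal N(t_k^i,i)}\frac{\mathbf a_{ij}(t_k^i)}{\sum_{l\in\mathcal N(t_k^i,i)}\mathbf a_{il}(t_k^i)}\bigl(x_j(t_k^i-\tau_{ij}^k)-x_i(t)\bigr), & \mathcal N(t_k^i,i)\neq\emptyset,\\ 0,&\text{otherwise.}\end{cases}$$ If there exists $T\ge 0$ such that for all $t^0\ge 0$ the union of the graph $\mathcal G^0(t)$ across the interval $[t^0,t^0+T]$ contains a spanning tree, then this system solves a consensus problem. Moreover, if the weighted graph $\mathcal G(\mathcal A(t))$ is time-invariant, then the solvability of the consensus problem by this system implies that $\mathcal G(\mathcal A(t))$ contains a spanning tree.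
   Context: $\mathbb Z_+$ is the set of nonnegative integers. There are $n$ agents with states $x_i(t)\in\mathbb R$, $x=[x_1,\dots,x_n]^T$. Graphs: a directed graph has an edge set of ordered pairs of vertices (self-loops allowed). For a nonnegative $n\times n$ matrix $A=[a_{ij}]$, $\mathcal G(A)$ is the weighted directed graph on $\{v_1,\dots,v_n\}$ with $(v_i,v_j)$ an edge iff $a_{ji}>0$ (weight $a_{ji}$). In an edge $(v_i,v_j)$, $v_i$ is the parent and $v_j$ the child. A directed tree is a directed graph in which every vertex except one (the root, which has no parent) has exactly one parent, and the root is connected to every other vertex by a directed path. A graph contains a spanning tree if a subset of its edges forms a directed tree on all its vertices. Update times: agent $i$ has update times $t_0^i,t_1^i,\dots$ with $t_0^i=0$ and $0<\check\tau_u\le t_{k+1}^i-t_k^i\le\hat\tau_u$ for all $k\in\mathbb Z_+$, where $\check\tau_u,\hat\tau_u$ are fixed reals; the update times of different agents need not be related. Topology: $\mathcal A(t)=[\mathbf a_{ij}(t)]$ is a nonnegative $n\times n$ matrix; there are reals $\hat{\mathbf a}\ge\check{\mathbf a}>0$ with $\check{\mathbf a}\le\mathbf a_{ij}(t)\le\hat{\mathbf a}$ whenever $\mathbf a_{ij}(t)\ne0$. $\mathcal N(t_k^i,i)$ is the set of indices $j\neq i$ of agents whose state information is received by agent $i$ at time $t_k^i$; it is contained in $\{j\ne i:\mathbf a_{ij}(t_k^i)>0\}$. Delays: $0\le\tau_{ij}^k\le\tau_d=K\check\tau_u$ for all $i$, $k\in\mathbb Z_+$, $j\in\mathcal N(t_k^i,i)$,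 with $K\in\mathbb Z_+$ fixed. The graph $\mathcal G^0(t)$, $t\ge0$, has vertices $v_1,\dots,v_n$; for $t\in[t_k^i,t_{k+1}^i)$, $(v_j,v_i)$ is an edge of $\mathcal G^0(t)$ iff $j\in\mathcal N(t_k^i,i)$ (so no self-loops). The union of $\mathcal G^0(t)$ across $[t^0,t^0+T]$ is the directed graph on the same vertices whose edge set is the union of the edge sets of $\mathcal G^0(t')$, $t'\in[t^0,t^0+T]$. The system solves a consensus problem if for any initial condition (here an initial function $x:[-\tau_d,0]\to\mathbb R^n$) the solution $x(t)$ converges as $t\to\infty$ to some $x^*$ (depending on the initial condition) with $x_i^*=x_j^*$ for all $i,j$. *)

(* Defs.v *)
From HB Require Import structures.
From mathcomp Require Import all_boot all_order all_algebra.
From mathcomp Require Import all_classical all_reals all_analysis.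
Import Order.TTheory GRing.Theory Num.Theory.
Import numFieldNormedType.Exports.

Set Implicit Arguments.
Unset Strict Implicit.
Unset Printing Implicit Defensive.

Local Open Scope ring_scope.

Section Digraphs.
Variable V : finType.

(* A directed graph on the vertex set V is its set of edges; [(u, v)] goes
   from the parent u to the child v. *)
Implicit Types E F : {set V * V}.

Definition edge_rel E : rel V := fun u v => (u, v) \in E.

Definition is_directed_tree F : Prop :=
  exists r : V,
    [/\ forall u, ~~ edge_rel F u r,
        forall v, v != r -> exists! u, edge_rel F u v
      & forall v, v != r -> connect (edge_rel F) r v].

Definition contains_spanning_tree E : Prop :=
  exists F, (F \subset E) /\ is_directed_tree F.

End Digraphs.

Section System.
Variables (R : realType) (n : nat).

(* Note the index reversal: the edge (v_i, v_j) carries the weight a_ji. *)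
Definition graph_of_mx (A : 'M[R]_n) : {set 'I_n * 'I_n} :=
  finset (fun e : 'I_n * 'I_n => 0 < A e.2 e.1).

Definition same_weighted_graph (A B : 'M[R]_n) : Prop :=
  graph_of_mx A = graph_of_mx B /\
  forall i j, (i, j) \in graph_of_mx A -> A j i = B j i.

Variables
  (upd : 'I_n -> nat -> R)              (* upd i k is t_k^i *)
  (A : R -> 'M[R]_n)
  (N : 'I_n -> nat -> {set 'I_n})       (* N i k is the set N(t_k^i, i) *)
  (tau : 'I_n -> 'I_n -> nat -> R)      (* tau i j k is tau_ij^k *)
  (taud : R).

Definition graph0 (t : R) : {set 'I_n * 'I_n} :=
  finset (fun e : 'I_n * 'I_n =>
    `[< exists k, upd e.2 k <= t < upd e.2 k.+1 /\ e.1 \in N e.2 k >]).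

Definition union_graph0 (a b : R) : {set 'I_n * 'I_n} :=
  finset (fun e : 'I_n * 'I_n =>
    `[< exists t : R, a <= t <= b /\ e \in graph0 t >]).

(* Right-hand side of the equation of agent i on [t_k^i, t_(k+1)^i), at t. *)
Definition velocity (x : R -> 'cV[R]_n) (i : 'I_n) (k : nat) (t : R) : R :=
  if N i k == finset.set0 then 0
  else \sum_(j in N i k)
         A (upd i k) i j / (\sum_(l in N i k) A (upd i k) i l)
         * (x (upd i k - tau i j k) j 0 - x t i 0).

(* The values of x before -taud are irrelevant.  The velocity of agent i may
   jump at t_k^i, so there the equation is imposed on the right derivative. *)
Definition is_solution (phi x : R -> 'cV[R]_n) : Prop :=
  [/\ forall t : R, - taud <= t <= 0 -> x t = phi t,
      ({within `[0, +oo[, continuous x})%classic,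
      forall i k (t : R), upd i k < t < upd i k.+1 ->
        is_derive t 1 (fun s => x s i 0) (velocity x i k t)
    & forall i k,
        (h^-1 * (x (upd i k + h) i 0 - x (upd i k) i 0) @[h --> 0^'+]
           --> velocity x i k (upd i k))%classic].

Definition reaches_consensus (x : R -> 'cV[R]_n) : Prop :=
  exists xs : 'cV[R]_n,
    (x t @[t --> +oo] --> xs)%classic /\ forall i j, xs i 0 = xs j 0.

(* The initial function phi is an arbitrary function on [-taud, 0] (only its
   restriction to that interval matters). *)
Definition solves_consensus : Prop :=
  forall phi : R -> 'cV[R]_n,
    (exists x, is_solution phi x) /\
    (forall x, is_solution phi x -> reaches_consensus x).

End System.

(* Main.v *)
Require Import Defs.
From HB Require Import structures.
From mathcomp Require Import all_boot all_order all_algebra.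
From mathcomp Require Import all_classical all_reals all_analysis.
From mathcomp Require Import ring lra.
Import Order.TTheory GRing.Theory Num.Theory.
Import numFieldNormedType.Exports.
Local Open Scope ring_scope.

(** Between two consecutive updates the equation of agent i reads
    x_i' = c - x_i, where the constant c is a convex combination of delayed
    states.  Hence x_i relaxes exponentially towards c, and on the whole
    interval [t_k, t_(k+1)] it is a convex combination of x_i(t_k) and of
    states at times at most t_k.  A solution is the same thing as a function
    obeying this explicit formula ([solution_trajectory],
    [trajectory_solution]).  As the value at a time t only refers to values at
    or before an update that strictly precedes t, and finitely many updates
    precede t, the formula defines a solution by well-founded recursion
    ([solution_exists]), and properties of solutions are proved by the
    corresponding induction ([event_ind]).

    Sufficiency.  Let D be the longest time over which the past acts (largest
    delay plus longest update interval).  If all states lie in [m, M] during a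
    period of length D, they do so for ever.  The excess x_i - m then decays at
    most exponentially, because e^t (x_i(t) - m) is nondecreasing
    ([excess_growth]), and an agent listening to an agent with a given excess
    acquires a fixed fraction of it ([excess_transfer]).  The same holds for
    the deficits M - x_i.  At a given time every agent has excess or deficit at
    least (M - m) / 2.  Call P the set of agents whose excess is known to be
    large and Q the same for the deficit; P and Q cover all agents.  During a
    window in which the union of the graphs has a spanning tree, the root lies
    in P or in Q, so that the tree has an edge leaving that set, and the set
    grows, unless it was already full; what counts as large shrinks by a fixed
    factor.  After n windows P or Q is full ([two_sided_spreading]), so that
    m can be raised or M lowered by a fixed proportion of M - m
    ([contraction_step]).  Iterating, the states are squeezed into intervals of
    arbitrarily small length ([trajectory_consensus]).

    Necessity.  A graph without spanning tree has two disjoint nonempty sets of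
    vertices that no edge enters ([disjoint_source_closed]).  The agents in
    each of them never hear of the others, so if the initial function is 0 on
    one set and 1 on the other, the solution keeps these values
    ([consensus_spanning_tree]). *)

Set Implicit Arguments.
Unset Strict Implicit.
Unset Printing Implicit Defensive.

(** * Spanning trees, roots and sets without entering edges *)

Section SpanningTrees.
Variable V : finType.
Implicit Types (E F : {set V * V}) (P : {set V}).

Definition is_root E (r : V) : Prop := forall v, connect (edge_rel E) r v.

Lemma connect_entering_edge (e : rel V) P r v :
  connect e r v -> r \in P -> v \notin P ->
  exists a b, [/\ a \in P, b \notin P & e a b].
Proof.
move=> /connectP[p]; elim: p r => [|y p IHp] r /=.
  by move=> _ -> ->.
move=> /andP[ery pth] vE rP vP; have [yP|yP] := boolP (y \in P).
  exact: (IHp y).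
by exists r, y.
Qed.

Lemma spanning_tree_root E : contains_spanning_tree E -> exists r, is_root E r.
Proof.
move=> [F [FE [r [_ _ Fconn]]]]; exists r => v.
have [->|vr] := eqVneq v r; first exact: connect0.
apply: connect_sub (Fconn v vr) => a b; rewrite /edge_rel => abF.
by apply: connect1; exact: (fintype.subsetP FE).
Qed.

(** The tree is a breadth-first one: every vertex other than r gets as parent
    some predecessor strictly closer to r. *)
Lemma root_spanning_tree E r : is_root E r -> contains_spanning_tree E.
Proof.
move=> rootr.
have exd v : exists k, [exists p : k.-tuple V,
    path (edge_rel E) r p && (v == last r p)].
  have /connectP[p pth lastp] := rootr v.
  by exists (size p); apply/existsP; exists (in_tuple p); rewrite pth lastp eqxx.
(* The distance from the root. *)
pose d v := ex_minn (exd v).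
have dpath v p : path (edge_rel E) r p -> v = last r p -> (d v <= size p)%N.
  move=> pth lastp; rewrite /d; case: ex_minnP => k _; apply.
  by apply/existsP; exists (in_tuple p); rewrite pth lastp eqxx.
have closer v : v != r -> exists u, edge_rel E u v && (d u < d v)%N.
  move=> vr; have : exists p, [/\ path (edge_rel E) r p, v = last r p & size p = d v].
    rewrite /d; case: ex_minnP => k /existsP[p /andP[pth /eqP lastp]] _.
    by exists p; rewrite size_tuple.
  move=> [p [+ + szp]]; case/lastP: p szp => [|p y].
    by move=> _ _ vE; rewrite vE eqxx in vr.
  rewrite size_rcons rcons_path last_rcons => szp /andP[pth ey] vE; subst y.
  by exists (last r p); rewrite ey -szp ltnS dpath.
pose par v := if [pick u | edge_rel E u v && (d u < d v)%N] is Some u then u else r.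
have parP v : v != r -> edge_rel E (par v) v && (d (par v) < d v)%N.
  move=> /closer[u uv]; rewrite /par; case: pickP => [w //|/(_ u)].
  by rewrite uv.
pose F := [set e : V * V | (e.2 != r) && (e.1 == par e.2)]%SET.
have FE u v : edge_rel F u v = (v != r) && (u == par v).
  by rewrite /edge_rel inE.
exists F; split.
  apply/fintype.subsetP => -[u v]; rewrite inE /= => /andP[vr /eqP ->].
  by have /andP[] := parP v vr.
exists r; split.
- by move=> u; rewrite FE eqxx.
- move=> v vr; exists (par v); split; first by rewrite FE vr eqxx.
  by move=> u; rewrite FE => /andP[_ /eqP].
move=> v; have [m] := ubnP (d v); elim: m v => // m IHm v dvm vr.
have /andP[_ dpar] := parP v vr.
apply: (@connect_trans _ _ (par v)); last by apply: connect1; rewrite FE vr eqxx.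
have [->|pr] := eqVneq (par v) r; first exact: connect0.
by apply: IHm => //; exact: leq_trans dpar _.
Qed.

Definition source_closed E P : Prop := forall u v, (u, v) \in E -> v \in P -> u \in P.

(** If any two nonempty sets without entering edges meet, a vertex r with the
    fewest ancestors is a root: each ancestor of r has the same ancestors as r,
    hence is reachable from r, and the ancestors of any v meet those of r. *)
Lemma disjoint_source_closed E (v0 : V) : ~ contains_spanning_tree E ->
  exists P Q v w, [/\ source_closed E P, source_closed E Q, v \in P, w \in Q
    & forall u, u \in P -> u \in Q -> False].
Proof.
move=> notree; apply: contrapT => nodisj; apply: notree.
pose anc v := finset (fun u => connect (edge_rel E) u v).
have ancE u v : (u \in anc v) = connect (edge_rel E) u v by rewrite inE.
have anc_closed v : source_closed E (anc v).
  move=> a b ab; rewrite !ancE; apply: connect_trans.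
  exact: connect1.
have [r _ rmin] := @arg_minnP _ v0 xpredT (fun v => #|anc v|) isT.
apply: (@root_spanning_tree _ r) => v.
have [w [wr wv]] : exists w, w \in anc r /\ w \in anc v.
  apply: contrapT => dis; apply: nodisj; exists (anc r), (anc v), r, v.
  split => // [||u ur uv]; rewrite ?ancE ?connect0 //.
  by apply: dis; exists u.
have subwr : anc w \subset anc r.
  by apply/fintype.subsetP => u; rewrite !ancE in wr *; move/connect_trans; apply.
have : anc w = anc r by apply/eqP; rewrite eqEcard subwr rmin.
move=> /setP /(_ r); rewrite !ancE connect0 => rw.
by apply: connect_trans rw _; rewrite -ancE.
Qed.

End SpanningTrees.

(** * Spreading along varying spanning trees *)

(** A common root of all the graphs E p would let a single family grow.  With
    varying roots, covering by two families is the remedy: each root lies in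
    one of them, so each step increases |P p| + |Q p|, which is at least |V|
    initially and at most 2 |V|, until one of the families is full. *)
Lemma two_sided_spreading (V : finType) (P Q : nat -> {set V})
    (E : nat -> {set V * V}) :
  (forall v, (v \in P 0%N) || (v \in Q 0%N)) ->
  (forall p, contains_spanning_tree (E p)) ->
  (forall p, P p \subset P p.+1) -> (forall p, Q p \subset Q p.+1) ->
  (forall p u v, (u, v) \in E p -> u \in P p -> v \in P p.+1) ->
  (forall p u v, (u, v) \in E p -> u \in Q p -> v \in Q p.+1) ->
  P #|V| = [set: V]%SET \/ Q #|V| = [set: V]%SET.
Proof.
move=> PQ0 tree PS QS PE QE.
have PQ p v : (v \in P p) || (v \in Q p).
  elim: p v => // p IHp v; have /orP[vP|vQ] := IHp v.
    by rewrite (fintype.subsetP (PS p)).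
  by rewrite (fintype.subsetP (QS p)) ?orbT.
have grow (S S' : {set V}) F r : is_root F r -> r \in S -> S \subset S' ->
    (forall u v, (u, v) \in F -> u \in S -> v \in S') ->
    S = [set: V]%SET \/ (#|S| < #|S'|)%N.
  move=> rootr rS SS' FS; have [ST|/subsetPn[v _ vS]] := boolP ([set: V]%SET \subset S).
    by left; apply/eqP; rewrite -finset.subTset.
  right; apply: proper_card; apply/properP; split=> //.
  have [a [b [aS bS ab]]] := connect_entering_edge (rootr v) rS vS.
  by exists b => //; exact: FS ab aS.
suff main p : [\/ P p = [set: V]%SET, Q p = [set: V]%SET
    | (#|V| + p <= #|P p| + #|Q p|)%N].
  have [||le2V] := main #|V|; [by left|by right|left].
  apply/eqP; rewrite eqEcard finset.subsetT cardsT -(leq_add2r #|V|).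
  by apply: leq_trans le2V _; rewrite leq_add2l max_card.
elim: p => [|p [PT|QT|IHp]].
- constructor 3; rewrite addn0 -cardsT; apply: leq_trans (leq_card_setU _ _).
  by apply/subset_leq_card/fintype.subsetP => v _; rewrite inE PQ.
- by constructor 1; apply/eqP; rewrite -finset.subTset -PT.
- by constructor 2; apply/eqP; rewrite -finset.subTset -QT.
have [r rootr] := spanning_tree_root (tree p).
have /orP[rP|rQ] := PQ p r.
  have [PT|lt] := grow _ _ _ _ rootr rP (PS p) (PE p).
    by constructor 1; apply/eqP; rewrite -finset.subTset -PT.
  constructor 3; rewrite addnS; apply: leq_ltn_trans IHp _.
  by rewrite -addSn leq_add // subset_leq_card.
have [QT|lt] := grow _ _ _ _ rootr rQ (QS p) (QE p).
  by constructor 2; apply/eqP; rewrite -finset.subTset -QT.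
constructor 3; rewrite addnS; apply: leq_ltn_trans IHp _.
by rewrite -addnS leq_add // subset_leq_card.
Qed.

(** * Exponential relaxation and convergence of matrices *)

Section Relaxation.
Variable R : realType.
Implicit Types (c y s t : R).

(** The value at time s of the solution of z' = c - z with z(0) = y. *)
Definition relax c y s : R := c + (y - c) * expR (- s).

Lemma relax0 c y : relax c y 0 = y.
Proof. by rewrite /relax oppr0 expR0 mulr1 addrC subrK. Qed.

Lemma relax_const c s : relax c c s = c.
Proof. by rewrite /relax subrr mul0r addr0. Qed.

Lemma relax_mean c y s : relax c y s = expR (- s) * y + (1 - expR (- s)) * c.
Proof. by rewrite /relax; ring. Qed.

Lemma is_derive_relax c y a t :
  is_derive t 1 (fun s => relax c y (s - a)) (c - relax c y (t - a)).
Proof.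
have -> : (fun s => relax c y (s - a))
    = cst c + (y - c) \*: (expR \o (- (id - cst a))) by apply/funext.
apply: is_derive_eq; rewrite /relax /= !fctE /GRing.scale /= /cst; ring.
Qed.

(** The function (x - c) e^(t - a) has derivative zero. *)
Lemma relax_unique (x : R -> R) c a b :
  (forall t, a < t < b -> is_derive t 1 x (c - x t)) ->
  ({within `[a, b], continuous x})%classic ->
  forall t, a <= t <= b -> x t = relax c (x a) (t - a).
Proof.
move=> dx cx t /andP[at_ tb].
pose f := fun s => (x s - c) * expR (s - a).
have df s : s \in `]a, t[ -> is_derive s 1 f 0.
  rewrite in_itv /= => /andP[as_ st].
  have dxs : is_derive s 1 x (c - x s) by apply: dx; rewrite as_ (lt_le_trans st).
  have -> : f = (x - cst c) * (expR \o (id - cst a)) by apply/funext.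
  apply: is_derive_eq; rewrite /= !fctE /GRing.scale /= /cst; ring.
have cf : ({within `[a, t], continuous f})%classic.
  have cxt : ({within `[a, t], continuous x})%classic.
    by apply: continuous_subspaceW cx; apply: subset_itvl; rewrite bnd_simp.
  have ce : ({within `[a, t], continuous (fun s => expR (s - a))})%classic.
    apply: continuous_subspaceT => u.
    apply: (@continuous_comp _ _ _ (fun s => s - a)); last exact: continuous_expR.
    by apply: cvgB; [exact: cvg_id|exact: cvg_cst].
  move=> s; apply: (@continuousM R (subspace `[a, t]%classic) (x - cst c)); last exact: ce.
  by apply: continuousB; [exact: cxt|exact: cst_continuous].
have [s _] := MVT_segment at_ df cf.
rewrite mul0r /f subrr expR0 mulr1 => /eqP; rewrite subr_eq0 => /eqP fE.
by rewrite /relax -fE expRN mulfK ?gt_eqF ?expR_gt0 //; ring.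
Qed.

End Relaxation.

Lemma cvg_mx_coord (T : Type) (R : topologicalType) (m n : nat)
    (F : set_system T) (FF : Filter F)
    (f : T -> 'M[R]_(m, n)) (l : 'M[R]_(m, n)) :
  (forall i j, (f t i j @[t --> F] --> l i j)%classic) ->
  (f t @[t --> F] --> l)%classic.
Proof.
move=> fl C [P nbP subC].
suff : F [set t | forall i j, P i j (f t i j)]%classic.
  by apply: (@filterS _ F FF) => t Pt; exact: subC.
apply: filter_forall => i; apply: filter_forall => j; exact/fl/nbP.
Qed.

(** * Update times *)

Section Schedule.
Variables (R : realType) (n : nat) (tau_check : R) (upd : 'I_n -> nat -> R).
Hypothesis tau_check_gt0 : 0 < tau_check.
Hypothesis upd0 : forall i, upd i 0%N = 0.
Hypothesis upd_gap : forall i k, tau_check <= upd i k.+1 - upd i k.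

Lemma upd_ltS i k : upd i k < upd i k.+1.
Proof. by rewrite -subr_gt0; exact: lt_le_trans (upd_gap i k). Qed.

Lemma upd_mono i : {homo upd i : k l / (k <= l)%N >-> k <= l}.
Proof.
apply: homo_leq => [//|y x z|k]; first exact: le_trans.
exact/ltW/upd_ltS.
Qed.

Lemma upd_ge0 i k : 0 <= upd i k.
Proof. by rewrite -(upd0 i) upd_mono. Qed.

Lemma upd_ge i k : k%:R * tau_check <= upd i k.
Proof.
elim: k => [|k IHk]; first by rewrite mul0r upd0.
by have := upd_gap i k; rewrite -natr1 mulrDl mul1r; lra.
Qed.

Lemma upd_unbounded i t : exists k, t <= upd i k.
Proof.
exists (Num.truncn (t / tau_check)).+1; apply: le_trans (upd_ge i _).
by rewrite -ler_pdivrMr //; exact/ltW/truncnS_gt.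
Qed.

(** The number of updates of agent i strictly before time t.  With strict
    inequality, t lies in ]t_k, t_(k+1)] when k + 1 updates precede it. *)
Definition nbefore i t : nat := ex_minn (upd_unbounded i t).

Lemma nbefore_le i t k : (nbefore i t <= k)%N = (t <= upd i k).
Proof.
rewrite /nbefore; case: ex_minnP => m tm minm; apply/idP/idP.
  by move=> /(upd_mono i); exact: le_trans.
exact: minm.
Qed.

Lemma nbefore_in i t k : upd i k < t <= upd i k.+1 -> nbefore i t = k.+1.
Proof.
move=> /andP[kt tk]; apply/eqP; rewrite eqn_leq nbefore_le tk.
by rewrite ltnNge nbefore_le -ltNge.
Qed.

Lemma update_interval i t : 0 < t -> exists k, upd i k < t <= upd i k.+1.
Proof.
move=> t0; case E : (nbefore i t) => [|k].
  have : (nbefore i t <= 0)%N by rewrite E.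
  by rewrite nbefore_le upd0 leNgt t0.
exists k; rewrite -nbefore_le E leqnn andbT.
by rewrite ltNge -nbefore_le E ltnn.
Qed.

Lemma update_interval_right i t : 0 <= t -> exists k, upd i k <= t < upd i k.+1.
Proof.
rewrite le_eqVlt => /predU1P[<-|/(update_interval i)[k /andP[kt]]].
  by exists 0%N; rewrite upd0 lexx -{1}(upd0 i) upd_ltS.
rewrite le_eqVlt => /predU1P[->|tk].
  by exists k.+1; rewrite lexx upd_ltS.
by exists k; rewrite (ltW kt).
Qed.

Lemma nbefore_mono i : {homo nbefore i : s t / s <= t >-> (s <= t)%N}.
Proof.
move=> s t st; rewrite nbefore_le; apply: le_trans st _.
by rewrite -nbefore_le.
Qed.

(** A termination measure: the state at time t is determined by states at or
    before updates that strictly precede t, hence at times of smaller rank. *)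
Definition rank t : nat := (\sum_i nbefore i t)%N.

Lemma rank_lt i k s t : s <= upd i k -> upd i k < t -> (rank s < rank t)%N.
Proof.
move=> sk kt; rewrite /rank (bigD1 i) //= [ltnRHS](bigD1 i) //=.
rewrite -addSn leq_add //; last first.
  by apply: leq_sum => j _; apply: nbefore_mono; exact: le_trans sk (ltW kt).
apply: (@leq_ltn_trans k); first by rewrite nbefore_le.
by rewrite ltnNge nbefore_le -ltNge.
Qed.

Lemma event_ind (P : R -> Prop) :
  (forall t, t <= 0 -> P t) ->
  (forall t, 0 < t ->
     (forall i k s, upd i k < t -> s <= upd i k -> P s) -> P t) ->
  forall t, P t.
Proof.
move=> P0 IH t; have [m] := ubnP (rank t); elim: m t => // m IHm t tm.
have [/P0//|t0] := leP t 0.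
apply: IH => // i k s kt sk; apply: IHm.
exact: leq_trans (rank_lt sk kt) tm.
Qed.

(** Monotonicity on each update interval suffices for monotonicity beyond a;
    intervals that straddle a only matter from a on. *)
Lemma upd_monotone_glue i a (f : R -> R) : 0 <= a ->
  (forall k s t, a <= s -> upd i k <= s -> s <= t -> t <= upd i k.+1 ->
     f s <= f t) ->
  forall s t, a <= s -> s <= t -> f s <= f t.
Proof.
move=> a0 fk s t as_ st.
have [m] := ubnP (nbefore i t); elim: m t st => // m IHm t.
rewrite le_eqVlt => /predU1P[<- //|st] tm.
have [k kt] := update_interval i (le_lt_trans a0 (le_lt_trans as_ st)).
have /andP[k1 k2] := kt.
have [ks|sk] := leP (upd i k) s; first by apply: (fk k) => //; exact: ltW.
apply: (@le_trans _ _ (f (upd i k))).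
  apply: IHm; first exact: ltW.
  move: tm; rewrite (nbefore_in kt) ltnS; apply: leq_ltn_trans.
  by rewrite nbefore_le.
by apply: (fk k) => //; [exact: le_trans as_ (ltW sk)|exact: ltW].
Qed.

End Schedule.

(** * Explicit form and existence of solutions *)

Section Trajectories.
Variables (R : realType) (n : nat) (tau_check taud : R).
Variables (upd : 'I_n -> nat -> R) (A : R -> 'M[R]_n).
Variables (N : 'I_n -> nat -> {set 'I_n}) (tau : 'I_n -> 'I_n -> nat -> R).
Hypothesis tau_check_gt0 : 0 < tau_check.
Hypothesis upd0 : forall i, upd i 0%N = 0.
Hypothesis upd_gap : forall i k, tau_check <= upd i k.+1 - upd i k.
Hypothesis N_pos : forall i k j, j \in N i k -> 0 < A (upd i k) i j.
Hypothesis tau_ge0 : forall i k j, j \in N i k -> 0 <= tau i j k.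
Implicit Type x : R -> 'cV[R]_n.

Definition weight i k j : R :=
  A (upd i k) i j / \sum_(l in N i k) A (upd i k) i l.

(** The constant towards which agent i relaxes after its k-th update.  An agent
    without neighbours stands still, that is, relaxes towards its own state;
    this choice makes one formula cover both cases of the equation. *)
Definition target x i k : R :=
  if N i k == finset.set0 then x (upd i k) i 0
  else \sum_(j in N i k) weight i k j * x (upd i k - tau i j k) j 0.

(** The integrated form of the system.  Both end points of the update interval
    are included, so that continuity is part of the formula. *)
Definition is_trajectory x : Prop := forall i k t, upd i k <= t <= upd i k.+1 ->
  x t i 0 = relax (target x i k) (x (upd i k) i 0) (t - upd i k).

Lemma weight_sum_gt0 i k : N i k != finset.set0 ->
  0 < \sum_(l in N i k) A (upd i k) i l.
Proof.
move=> /set0Pn[j jN]; rewrite (bigD1 j) //= ltr_pwDl ?N_pos //.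
by apply: sumr_ge0 => l /andP[lN _]; exact/ltW/N_pos.
Qed.

Lemma weight_ge0 i k j : j \in N i k -> 0 <= weight i k j.
Proof.
move=> jN; rewrite divr_ge0 ?(ltW (N_pos jN)) //.
by apply: sumr_ge0 => l lN; exact/ltW/N_pos.
Qed.

Lemma sum_weight i k : N i k != finset.set0 -> \sum_(j in N i k) weight i k j = 1.
Proof. by move=> Nk; rewrite -mulr_suml divff // gt_eqF // weight_sum_gt0. Qed.

(** The weights add up to 1 when there are neighbours; the hypothesis makes the
    right-hand side vanish when there are none. *)
Lemma velocityE x i k t :
  (N i k = finset.set0 -> x t i 0 = x (upd i k) i 0) ->
  velocity upd A N tau x i k t = target x i k - x t i 0.
Proof.
rewrite /velocity /target; case: eqP => [-> /(_ erefl) ->|/eqP Nk _].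
  by rewrite subrr.
rewrite -[x t i 0 in RHS]mul1r -(sum_weight Nk) mulr_suml -sumrB.
by apply: eq_bigr => j _; rewrite /weight mulrBr.
Qed.

Lemma coord_within_continuous (D : set R) x i :
  ({within D, continuous x} -> {within D, continuous (fun t => x t i 0)})%classic.
Proof.
move=> cx t.
apply: (@continuous_comp (subspace D) _ _ x (fun M : 'cV[R]_n => M i 0)).
  exact: cx.
exact: coord_continuous.
Qed.

Lemma solution_trajectory phi x :
  is_solution upd A N tau taud phi x -> is_trajectory x.
Proof.
move=> [_ /coord_within_continuous cx dx _] i k t tk.
have cxk : ({within `[upd i k, upd i k.+1], continuous (fun t => x t i 0)})%classic.
  apply: continuous_subspaceW (cx i) => s /=; rewrite !in_itv /= andbT.
  by move=> /andP[+ _]; apply: le_trans; exact: upd_ge0 upd_gap _ _.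
have Nk0 : N i k = finset.set0 ->
    forall s, upd i k <= s <= upd i k.+1 -> x s i 0 = x (upd i k) i 0.
  move=> Nk s /andP[ks sk].
  have cxs : ({within `[upd i k, s], continuous (fun t => x t i 0)})%classic.
    by apply: continuous_subspaceW cxk; apply: subset_itvl; rewrite bnd_simp.
  have [|r _] := MVT_segment (df := cst 0) ks _ cxs.
    move=> r; rewrite in_itv /= => /andP[kr rs].
    have := dx i k r; rewrite kr (lt_le_trans rs sk) => /(_ isT).
    by rewrite /velocity Nk eqxx.
  by move=> /eqP; rewrite mul0r subr_eq0 => /eqP.
apply: relax_unique cxk _ tk => s /andP[ks sk].
rewrite -velocityE; first by apply: dx; rewrite ks sk.
by move/Nk0; apply; rewrite !ltW.
Qed.

Lemma relax_continuous c y a : continuous (fun t : R => relax c y (t - a)).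
Proof.
move=> t; apply: differentiable_continuous; apply/derivable1_diffP.
by apply: ex_derive; exact: is_derive_relax.
Qed.

(** The formula on ]t_k, t_(k+1)] gives the left limit at each positive time,
    the formula on [t_k, t_(k+1)[ gives the right limit. *)
Lemma trajectory_continuous x i : is_trajectory x ->
  ({within `[0, +oo[, continuous (fun t => x t i 0)})%classic.
Proof.
move=> trx.
have right t : 0 <= t -> (x s i 0 @[s --> t^'+] --> x t i 0)%classic.
  move=> /(update_interval_right tau_check_gt0 upd0 upd_gap i)[k /andP[kt tk]].
  rewrite (trx i k) ?kt ?(ltW tk) //.
  apply: cvg_trans (cvg_at_right_filter (@relax_continuous _ _ _ _)).
  apply: near_eq_cvg; near=> s.
  rewrite [RHS](trx i k) //; apply/andP; split.
    by apply: le_trans kt _; near: s; exact: nbhs_right_ge.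
  by near: s; apply: nbhs_right_le.
have left t : 0 < t -> (x s i 0 @[s --> t^'-] --> x t i 0)%classic.
  move=> /(update_interval tau_check_gt0 upd0 upd_gap i)[k /andP[kt tk]].
  rewrite (trx i k) ?tk ?(ltW kt) //.
  apply: cvg_trans (cvg_at_left_filter (@relax_continuous _ _ _ _)).
  apply: near_eq_cvg; near=> s.
  rewrite [RHS](trx i k) //; apply/andP; split.
    by near: s; apply: nbhs_left_ge.
  by apply: le_trans _ tk; near: s; exact: nbhs_left_le.
apply/continuous_within_itvcyP; split; last exact: right.
move=> t; rewrite in_itv /= andbT => t0.
by apply/left_right_continuousP; split; [exact: left|exact/right/ltW].
Unshelve. all: by end_near. Qed.

Lemma trajectory_solution phi x : (forall t, t <= 0 -> x t = phi t) ->
  is_trajectory x -> is_solution upd A N tau taud phi x.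
Proof.
move=> x0 trx.
have Nk0 i k s : upd i k <= s <= upd i k.+1 -> N i k = finset.set0 ->
    x s i 0 = x (upd i k) i 0.
  by move=> ks Nk; rewrite (trx i k) // /target Nk eqxx relax_const.
split.
- by move=> t /andP[_]; exact: x0.
- move=> t; apply: cvg_mx_coord => i j; rewrite ord1.
  exact: (@trajectory_continuous x i trx t).
- move=> i k t /andP[kt tk].
  rewrite velocityE; last by apply: Nk0; rewrite !ltW.
  rewrite (trx i k t); last by rewrite !ltW.
  apply: near_eq_is_derive (is_derive_relax _ _ _ _).
  near=> s; have : s \in `]upd i k, upd i k.+1[.
    by near: s; apply: near_in_itvoo; rewrite in_itv /= kt.
  by rewrite in_itv /= => /andP[ks sk]; rewrite [RHS](trx i k) // !ltW.
- move=> i k; rewrite velocityE //.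
  set c := target x i k; set y := x (upd i k) i 0.
  have [dcvg] := is_derive_relax c y (upd i k) (upd i k).
  rewrite subrr relax0 => dE; rewrite -[c - y]dE.
  apply: cvg_trans (cvg_dnbhs_at_right dcvg).
  apply: near_eq_cvg; near=> h.
  have h0 : 0 < h by near: h; exact: nbhs_right_gt.
  rewrite /= {3}/y (trx i k (upd i k + h)).
    by rewrite subrr relax0 /GRing.scale /= mulr1 (addrC h).
  rewrite lerDl ltW //= -lerBrDl; near: h; apply: nbhs_right_le.
  by rewrite subr_gt0; exact: upd_ltS upd_gap _ _.
Unshelve. all: by end_near. Qed.

Variable phi : R -> 'cV[R]_n.

(** One pass of the explicit formula; a fixed point is a solution with initial
    function phi. *)
Definition evolve x (t : R) : 'cV[R]_n :=
  if t <= 0 then phi t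
  else \col_i (let k := (nbefore tau_check_gt0 upd0 upd_gap i t).-1 in
               relax (target x i k) (x (upd i k) i 0) (t - upd i k)).

Lemma evolve_local x y t :
  (forall i k s, upd i k < t -> s <= upd i k -> x s = y s) -> evolve x t = evolve y t.
Proof.
move=> xy; rewrite /evolve; have [//|t0] := leP t 0.
apply/colP => i; rewrite !mxE.
have [k kt] := update_interval tau_check_gt0 upd0 upd_gap i t0.
rewrite (nbefore_in _ _ _ kt) /=; have /andP[{}kt _] := kt.
rewrite (xy i k) //; congr relax; rewrite /target (xy i k) //.
case: ifP => // _; apply: eq_bigr => j jN; rewrite (xy i k) //.
by rewrite gerBl tau_ge0.
Qed.

(** By locality, m passes settle the values at all times of rank below m,
    whatever function they start from. *)
Lemma evolve_fixpoint : exists x, forall t, x t = evolve x t.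
Proof.
pose rk := rank tau_check_gt0 upd0 upd_gap.
pose approx m := iter m evolve phi.
have stable m m' t : (rk t < m)%N -> (m <= m')%N -> approx m t = approx m' t.
  elim: m m' t => // m IHm [//|m'] t tm mm'; apply: evolve_local => i k s kt sk.
  by apply: IHm => //; exact: leq_trans (rank_lt _ _ _ sk kt) tm.
exists (fun t => approx (rk t).+1 t) => t; apply: evolve_local => i k s kt sk.
by apply/esym/stable => //; exact: rank_lt sk kt.
Qed.

Lemma solution_exists : exists x, is_solution upd A N tau taud phi x.
Proof.
have [x xE] := evolve_fixpoint; exists x; apply: trajectory_solution.
  by move=> t t0; rewrite xE /evolve t0.
move=> i k t /andP[]; rewrite le_eqVlt => /predU1P[<- _|kt tk].
  by rewrite subrr relax0.
have t0 : 0 < t by apply: le_lt_trans kt; exact: upd_ge0 upd_gap _ _.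
rewrite {1}xE /evolve leNgt t0 mxE.
by rewrite (@nbefore_in _ _ _ _ _ _ _ i t k) // kt.
Qed.

End Trajectories.

(** * Sufficiency: contraction of the range of the states *)

Section Contraction.
Variables (R : realType) (n : nat) (tau_check tau_hat taud alpha T : R).
Variables (upd : 'I_n -> nat -> R) (A : R -> 'M[R]_n).
Variables (N : 'I_n -> nat -> {set 'I_n}) (tau : 'I_n -> 'I_n -> nat -> R).
Hypothesis tau_check_gt0 : 0 < tau_check.
Hypothesis upd0 : forall i, upd i 0%N = 0.
Hypothesis upd_step : forall i k, tau_check <= upd i k.+1 - upd i k <= tau_hat.
Hypothesis N_pos : forall i k j, j \in N i k -> 0 < A (upd i k) i j.
Hypothesis tau_bounds : forall i k j, j \in N i k -> 0 <= tau i j k <= taud.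
Hypothesis tau_hat_ge0 : 0 <= tau_hat.
Hypothesis taud_ge0 : 0 <= taud.
Hypothesis alpha_gt0 : 0 < alpha.
Hypothesis alpha_le1 : alpha <= 1.
Hypothesis weight_ge : forall i k j, j \in N i k -> alpha <= weight upd A N i k j.
Implicit Type x : R -> 'cV[R]_n.

Local Notation is_trajectory := (is_trajectory upd A N tau).
Local Notation target := (target upd A N tau).

Let upd_gap i k : tau_check <= upd i k.+1 - upd i k.
Proof. by have /andP[] := upd_step i k. Qed.

Let upd_max i k : upd i k.+1 <= upd i k + tau_hat.
Proof. by have /andP[_] := upd_step i k; lra. Qed.

(** The behaviour after time s only depends on the states during the preceding
    memory span: the current update interval started at most tau_hat before s,
    and used states at most taud older. *)
Definition memory : R := taud + tau_hat.

Lemma memory_ge0 : 0 <= memory. Proof. exact: addr_ge0. Qed.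

Lemma target_ge x m i k : m <= x (upd i k) i 0 ->
  (forall j, j \in N i k -> m <= x (upd i k - tau i j k) j 0) -> m <= target x i k.
Proof.
move=> mx mN; rewrite /target; case: eqP => // /eqP Nk.
rewrite -[m]mul1r -(sum_weight N_pos Nk) mulr_suml.
by apply: ler_sum => j jN; rewrite ler_wpM2l ?weight_ge0 ?mN.
Qed.

Lemma relax_ge (m c y s : R) : 0 <= s -> m <= c -> m <= y -> m <= relax c y s.
Proof.
move=> s0 mc my; have e0 := expR_ge0 (- s).
have e1 : expR (- s) <= 1 by rewrite -expR0 ler_expR oppr_le0.
by rewrite relax_mean; nra.
Qed.

Definition bounded_below x s m := forall i t, s - memory <= t <= s -> m <= x t i 0.

Section LowerBound.
Variables (x : R -> 'cV[R]_n) (s m : R).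
Hypothesis trx : is_trajectory x.
Hypothesis s_ge : memory <= s.
Hypothesis xm : bounded_below x s m.

Lemma lower_bound_persists i t : s - memory <= t -> m <= x t i 0.
Proof.
move: t i.
apply: (event_ind tau_check_gt0 upd0 upd_gap) => [t t0 i st|t t0 IH i st].
  by apply: xm; rewrite st; have := memory_ge0; have := s_ge; lra.
have [ts|{}st] := leP t s; first by apply: xm; rewrite st ts.
have [k kt] := update_interval tau_check_gt0 upd0 upd_gap i t0.
have /andP[k1 k2] := kt; have kmax := upd_max i k; have td := taud_ge0.
rewrite (trx (k := k)); last by rewrite ltW.
have sk u : upd i k - taud <= u -> s - memory <= u by rewrite /memory; lra.
apply: relax_ge; first by rewrite subr_ge0 ltW.
  apply: target_ge => [|j jN]; first by apply: (IH i k) => //; apply: sk; lra.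
  have /andP[d0 dd] := tau_bounds jN.
  by apply: (IH i k) => //; [lra|apply: sk; lra].
by apply: (IH i k) => //; apply: sk; lra.
Qed.

Lemma target_lower_bound i k : s <= upd i k + tau_hat -> m <= target x i k.
Proof.
move=> sk; apply: target_ge => [|j jN]; apply: lower_bound_persists; rewrite /memory.
  by have := taud_ge0; lra.
by have /andP[] := tau_bounds jN; lra.
Qed.

(** On an update interval e^t (x_i(t) - m) equals e^t (c - m) plus a constant,
    where c is the target, and c is at least m. *)
Lemma excess_growth i t t' : s <= t' -> t' <= t ->
  expR t' * (x t' i 0 - m) <= expR t * (x t i 0 - m).
Proof.
move: t' t.
apply: (upd_monotone_glue tau_check_gt0 upd0 upd_gap (i := i)
  (f := fun t => expR t * (x t i 0 - m))).
  exact: le_trans memory_ge0 s_ge.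
move=> k t' t st' kt' t't tk.
rewrite (trx (k := k) (t := t')) ?kt' ?(le_trans t't) //.
rewrite (trx (k := k) (t := t)) ?tk ?(le_trans kt') //.
have expand u : expR u * (relax (target x i k) (x (upd i k) i 0) (u - upd i k) - m)
    = expR u * (target x i k - m) + (x (upd i k) i 0 - target x i k) * expR (upd i k).
  rewrite /relax opprB addrC; have -> : expR (upd i k - u) = expR (upd i k) / expR u.
    by rewrite expRD expRN.
  have : expR u != 0 by rewrite gt_eqF ?expR_gt0.
  by move=> ?; field.
rewrite !expand lerD2r ler_wpM2r ?ler_expR // subr_ge0 target_lower_bound //.
by have := upd_max i k; lra.
Qed.

Lemma excess_decay i t t' : s <= t' -> t' <= t ->
  expR (t' - t) * (x t' i 0 - m) <= x t i 0 - m.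
Proof.
move=> st' t't; have := excess_growth i st' t't.
by rewrite expRD expRN mulrAC ler_pdivrMr ?expR_gt0 // [X in _ <= X]mulrC.
Qed.

(** Neighbour j contributes weight at least alpha to the target, and during an
    interval of length at least tau_check the state covers at least the
    proportion 1 - e^(- tau_check) of the way to the target. *)
Lemma excess_transfer i j k : j \in N i k -> s + taud <= upd i k ->
  alpha * (1 - expR (- tau_check)) * (x (upd i k - tau i j k) j 0 - m)
    <= x (upd i k.+1) i 0 - m.
Proof.
move=> jN sk; have /andP[d0 dd] := tau_bounds jN.
have gN l : l \in N i k -> m <= x (upd i k - tau i l k) l 0.
  move=> lN; have /andP[] := tau_bounds lN => ? ?.
  by apply: lower_bound_persists; have := memory_ge0; lra.
have gi : m <= x (upd i k) i 0.
  by apply: lower_bound_persists; have := memory_ge0; have := taud_ge0; lra.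
have Nk : N i k != finset.set0 by apply/set0Pn; exists j.
rewrite (trx (k := k) (t := upd i k.+1)); last first.
  by rewrite lexx andbT ltW // (upd_ltS tau_check_gt0 upd_gap).
set h := upd i k.+1 - upd i k.
have tc : alpha * (x (upd i k - tau i j k) j 0 - m) <= target x i k - m.
  have -> : target x i k - m
     = \sum_(l in N i k) weight upd A N i k l * (x (upd i k - tau i l k) l 0 - m).
    rewrite /target (negbTE Nk) -[X in _ - X]mul1r -(sum_weight N_pos Nk) mulr_suml.
    by rewrite -sumrB; apply: eq_bigr => l _; rewrite mulrBr.
  rewrite (bigD1 j) //= ler_wpDr //.
    apply: sumr_ge0 => l /andP[lN _].
    by rewrite mulr_ge0 ?weight_ge0 // subr_ge0 gN.
  by rewrite ler_wpM2r ?weight_ge // subr_ge0 gN.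
have eh : expR (- h) <= expR (- tau_check) by rewrite ler_expR lerN2 upd_gap.
have ec : expR (- tau_check) <= 1 by rewrite -expR0 ler_expR oppr_le0 ltW.
have e0 := expR_ge0 (- h).
have gj : 0 <= x (upd i k - tau i j k) j 0 - m by rewrite subr_ge0 gN.
have ag : 0 <= alpha * (x (upd i k - tau i j k) j 0 - m).
  by rewrite mulr_ge0 // ltW.
rewrite relax_mean mulrAC.
apply: (@le_trans _ _ ((1 - expR (- h)) * (target x i k - m))).
  rewrite mulrC; apply: ler_pM => //; lra.
have : 0 <= expR (- h) * (x (upd i k) i 0 - m) by rewrite mulr_ge0 // subr_ge0.
by lra.
Qed.

End LowerBound.

Hypothesis T_ge0 : 0 <= T.

(** Edges present at some time of [s + memory, s + memory + T] belong to update
    intervals contained in [s, s + window], and use states from that period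
    only. *)
Definition window : R := memory + T + tau_hat.
(** One factor e^(- window) for the decay of the neighbour's excess before it
    is used, one for the decay of the agent's own excess afterwards. *)
Definition rate : R := alpha * (1 - expR (- tau_check)) * expR (- window) ^+ 2.

Lemma window_ge0 : 0 <= window.
Proof. by rewrite !addr_ge0. Qed.

Lemma rate_gt0 : 0 < rate.
Proof.
rewrite !mulr_gt0 ?expR_gt0 // subr_gt0 -expR0 ltr_expR oppr_lt0 //.
Qed.

Lemma rate_le : rate <= expR (- window).
Proof.
have e1 : expR (- window) <= 1 by rewrite -expR0 ler_expR oppr_le0 window_ge0.
have e0 := expR_ge0 (- window).
have c1 : expR (- tau_check) <= 1 by rewrite -expR0 ler_expR oppr_le0 ltW.
have c0 := expR_ge0 (- tau_check).
rewrite /rate expr2 mulrA; apply: ler_piMl => //.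
by rewrite !mulr_ile1 ?mulr_ge0 ?subr_ge0 ?(ltW alpha_gt0) //; lra.
Qed.

Section OneWindow.
Variables (x : R -> 'cV[R]_n) (s m : R).
Hypothesis trx : is_trajectory x.
Hypothesis s_ge : memory <= s.
Hypothesis xm : bounded_below x s m.

Lemma excess_decay_window u i t t' : s <= t' -> t' <= t -> t <= t' + window ->
  0 <= u -> u <= x t' i 0 - m -> expR (- window) * u <= x t i 0 - m.
Proof.
move=> st' t't tw u0 ux; apply: le_trans (excess_decay trx s_ge xm i st' t't).
by apply: ler_pM => //; rewrite ler_expR; lra.
Qed.

Lemma excess_kept e i : 0 <= e -> e <= x s i 0 - m -> rate * e <= x (s + window) i 0 - m.
Proof.
move=> e0 ex; have w0 := window_ge0.
apply: le_trans (@excess_decay_window e i (s + window) s _ _ _ _ _) => //; last 1 first.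
- by lra.
by rewrite ler_wpM2r ?rate_le.
Qed.

Lemma excess_spread e j i : 0 <= e ->
  (j, i) \in union_graph0 upd N (s + memory) (s + memory + T) ->
  e <= x s j 0 - m -> rate * e <= x (s + window) i 0 - m.
Proof.
move=> e0; rewrite inE => /asboolP[t [/andP[st tT]]].
rewrite inE => /asboolP[k /= [/andP[kt tk] jN]] ex.
have kmax := upd_max i k; have /andP[d0 dd] := tau_bounds jN.
have := taud_ge0; move: st tT; rewrite /memory => st tT ?.
have ej : expR (- window) * e <= x (upd i k - tau i j k) j 0 - m.
  by apply: (excess_decay_window (t' := s)) => //; rewrite /window /memory; lra.
have ei := excess_transfer trx s_ge xm jN.
have {}ei : alpha * (1 - expR (- tau_check)) * (expR (- window) * e)
    <= x (upd i k.+1) i 0 - m.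
  apply: le_trans (ei _); last by lra.
  rewrite ler_wpM2l // mulr_ge0 ?(ltW alpha_gt0) // subr_ge0 -expR0 ler_expR.
  by rewrite oppr_le0 ltW.
have -> : rate * e = expR (- window) *
    (alpha * (1 - expR (- tau_check)) * (expR (- window) * e)).
  by rewrite /rate; ring.
apply: excess_decay_window ei; rewrite /window /memory; try lra.
rewrite !mulr_ge0 ?expR_ge0 ?(ltW alpha_gt0) // subr_ge0 -expR0 ler_expR.
by rewrite oppr_le0 ltW.
Qed.

End OneWindow.

Lemma bounded_below_later x s s' m : is_trajectory x -> memory <= s -> s <= s' ->
  bounded_below x s m -> bounded_below x s' m.
Proof.
move=> trx s_ge ss' xm i t /andP[st _].
by apply: (lower_bound_persists trx s_ge xm); apply: le_trans st; rewrite lerB.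
Qed.

(** The extra window makes the improved bound valid during a whole memory
    span, as required to use it for all later times. *)
Lemma bounded_below_raise x s m e : is_trajectory x -> memory <= s ->
  bounded_below x s m -> 0 <= e -> (forall i, e <= x s i 0 - m) ->
  bounded_below x (s + window) (m + rate * e).
Proof.
move=> trx s_ge xm e0 ex i t /andP[st tw].
rewrite addrC -lerBrDr; apply: le_trans (ler_wpM2r e0 rate_le) _.
apply: (excess_decay_window trx s_ge xm (t' := s)) => //.
apply: le_trans st; rewrite -addrA lerDl.
have -> : window - memory = T + tau_hat by rewrite /window; ring.
exact: addr_ge0.
Qed.

Lemma target_opp x i k : target (fun t => - x t) i k = - target x i k.
Proof.
rewrite /target; case: ifP => _; first by rewrite mxE.
by rewrite -sumrN; apply: eq_bigr => j _; rewrite mxE mulrN.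
Qed.

Lemma trajectory_opp x : is_trajectory x -> is_trajectory (fun t => - x t).
Proof.
by move=> trx i k t kt; rewrite target_opp !mxE (trx i k t kt) /relax; ring.
Qed.

(** Upper bounds are lower bounds of the opposite trajectory, so that every
    one-sided result applies to both. *)
Definition confined x s m M :=
  bounded_below x s m /\ bounded_below (fun t => - x t) s (- M).

Hypothesis n_gt0 : (0 < n)%N.
Hypothesis tree : forall t, 0 <= t ->
  contains_spanning_tree (union_graph0 upd N t (t + T)).

(** The range loses rate^(n+1) times the initial excess (M - m) / 2: one factor
    for each of the n windows needed to reach all agents, and one for the
    window over which the improved bound is observed. *)
Definition contraction_factor : R := 1 - rate ^+ n.+1 / 2.

(** The thresholds rate^p e decrease with the window number p, which absorbs
    both the decay of known excesses and the loss in transmission. *)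
Lemma contraction_step x s m M : is_trajectory x -> memory <= s -> confined x s m M ->
  exists s' m' M', [/\ memory <= s', confined x s' m' M'
    & M' - m' = contraction_factor * (M - m)].
Proof.
move=> trx s_ge [xm xM]; have try := trajectory_opp trx.
pose y t := - x t; pose e := (M - m) / 2; pose st p := s + p%:R * window.
have st_ge p : s <= st p by rewrite lerDl mulr_ge0 ?window_ge0.
have stS p : st p.+1 = st p + window by rewrite /st -natr1; ring.
have memst p : memory <= st p by exact: le_trans (st_ge p).
have xmp p := bounded_below_later trx s_ge (st_ge p) xm.
have xMp p := bounded_below_later try s_ge (st_ge p) xM.
have e0 : 0 <= e.
  have ms : s - memory <= s <= s by rewrite lexx andbT gerBl memory_ge0.
  have := xm (Ordinal n_gt0) s ms; have := xM (Ordinal n_gt0) s ms.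
  by rewrite mxE /e; lra.
have ep0 p : 0 <= rate ^+ p * e by rewrite mulr_ge0 // exprn_ge0 // ltW ?rate_gt0.
pose P p := finset (fun i => rate ^+ p * e <= x (st p) i 0 - m).
pose Q p := finset (fun i => rate ^+ p * e <= y (st p) i 0 - - M).
pose E p := union_graph0 upd N (st p + memory) (st p + memory + T).
have PQ0 i : (i \in P 0%N) || (i \in Q 0%N).
  rewrite !inE expr0 mul1r /st mul0r addr0 /y mxE /e.
  by case: leP => //= ?; lra.
have treeE p : contains_spanning_tree (E p).
  by apply: tree; rewrite addr_ge0 ?memory_ge0 // (le_trans memory_ge0).
have [||||PT|QT] := two_sided_spreading PQ0 treeE.
- move=> p; apply/fintype.subsetP => i; rewrite !inE stS exprS -mulrA.
  exact: excess_kept.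
- move=> p; apply/fintype.subsetP => i; rewrite !inE stS exprS -mulrA.
  exact: excess_kept.
- move=> p j i ji; rewrite !inE stS exprS -mulrA.
  exact: excess_spread ji.
- move=> p j i ji; rewrite !inE stS exprS -mulrA.
  exact: excess_spread ji.
- exists (st n.+1), (m + rate ^+ n.+1 * e), M; split=> //.
    split=> //; rewrite stS exprS -mulrA; apply: bounded_below_raise => // i.
    by move/setP: PT => /(_ i); rewrite !inE card_ord.
  by rewrite /contraction_factor /e; ring.
exists (st n.+1), m, (M - rate ^+ n.+1 * e); split=> //.
  split=> //; rewrite opprB addrC stS exprS -mulrA; apply: bounded_below_raise => // i.
  by move/setP: QT => /(_ i); rewrite !inE card_ord.
by rewrite /contraction_factor /e; ring.
Qed.

Lemma contraction_factor_itv : 0 <= contraction_factor < 1.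
Proof.
have r0 := rate_gt0; have r1 : rate <= 1.
  by apply: le_trans rate_le _; rewrite -expR0 ler_expR oppr_le0 window_ge0.
have : rate ^+ n.+1 <= 1 by apply: exprn_ile1 => //; exact: ltW.
have : 0 < rate ^+ n.+1 by rewrite exprn_gt0.
by rewrite /contraction_factor; lra.
Qed.

(** The iteration starts with the period [0, memory], on which the states are
    bounded by continuity; the initial function itself may be unbounded. *)
Lemma eventually_close x e : is_trajectory x -> 0 < e ->
  exists s m M, [/\ memory <= s, confined x s m M & M - m <= e].
Proof.
move=> trx e0.
have bnd z : is_trajectory z -> exists C, bounded_below z memory C.
  move=> trz.
  have cz i := trajectory_continuous tau_check_gt0 upd0 upd_gap (i := i) trz.
  have czD i : ({within `[0, memory], continuous (fun t => z t i 0)})%classic.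
    apply: continuous_subspaceW (cz i) => t /=; rewrite !in_itv /= andbT.
    by case/andP.
  have lbi i : exists C, forall t, 0 <= t <= memory -> C <= z t i 0.
    have [c _ cP] := EVT_min memory_ge0 (czD i).
    by exists (z c i 0) => t t0; apply: cP; rewrite in_itv.
  have [C CP] := choice lbi.
  exists (- \sum_i `|C i|) => i t; rewrite subrr => t0.
  apply: le_trans (CP i t t0); rewrite lerNl.
  apply: (@le_trans _ _ `|C i|); first by rewrite -normrN ler_norm.
  by rewrite (bigD1 i) //= lerDl sumr_ge0.
have [m0 xm] := bnd x trx.
have [M0 xM] := bnd _ (trajectory_opp trx).
have iter l : exists s m M, [/\ memory <= s, confined x s m M
    & M - m = contraction_factor ^+ l * (- M0 - m0)].
  elim: l => [|l [s [m [M [s_ge cf wid]]]]].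
    exists memory, m0, (- M0); split=> //; last by rewrite mul1r.
    by split=> //; rewrite opprK.
  have [s' [m' [M' [s'_ge cf' wid']]]] := contraction_step trx s_ge cf.
  by exists s', m', M'; split=> //; rewrite wid' wid exprS mulrA.
have /andP[q0 q1] := contraction_factor_itv.
have : (contraction_factor ^+ l @[l --> \oo] --> (0 : R))%classic.
  by apply: cvg_expr; rewrite ger0_norm.
pose C := `|- M0 - m0| + 1.
have C0 : 0 < C by rewrite ltr_wpDl.
move=> /cvgrPdist_le /(_ (e / C)) []; first exact: divr_gt0.
move=> l _ /(_ l) /= /(_ (leqnn l)).
rewrite sub0r normrN ger0_norm ?exprn_ge0 // ler_pdivlMr // => ql.
have [s [m [M [s_ge cf wid]]]] := iter l.
exists s, m, M; split=> //; rewrite wid; apply: le_trans ql.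
by rewrite ler_wpM2l ?exprn_ge0 // (le_trans (ler_norm _)) // lerDl.
Qed.

Lemma trajectory_consensus x : is_trajectory x -> reaches_consensus x.
Proof.
move=> trx.
(* The common limit is the limit inferior of the states. *)
pose S := (fun y : R => exists s, forall t i, s <= t -> y <= x t i 0) : set R.
have env e : 0 < e -> exists s m M, [/\ M - m <= e
    & forall t i, s <= t -> m <= x t i 0 <= M].
  move=> e0; have [s [m [M [s_ge [xm xM] wid]]]] := eventually_close trx e0.
  exists s, m, M; split=> // t i st.
  have st' : s - memory <= t by rewrite (le_trans _ st) // gerBl memory_ge0.
  rewrite (lower_bound_persists trx s_ge xm) //=.
  rewrite -lerN2; have := lower_bound_persists (trajectory_opp trx) s_ge xM i st'.
  by rewrite mxE.
have SM s M y : (forall t i, s <= t -> x t i 0 <= M) -> S y -> y <= M.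
  move=> xM [s' Sy]; pose t := Num.max s s'; pose i := Ordinal n_gt0.
  by apply: le_trans (xM t i _); [apply: Sy|]; rewrite le_max lexx ?orbT.
have supS e : 0 < e -> exists s, forall t i, s <= t -> `|sup S - x t i 0| <= e.
  move=> /env[s [m [M [wid xmM]]]]; exists s => t i st.
  have Sm : S m by exists s => u j su; have /andP[] := xmM u j su.
  have ubM : ubound S M.
    by move=> y; apply: (SM s) => u j su; have /andP[] := xmM u j su.
  have mS : m <= sup S by apply: ub_le_sup => //; exists M.
  have SM' : sup S <= M by apply: ge_sup => //; exists m.
  have /andP[m1 M1] := xmM t i st.
  by rewrite ler_norml; lra.
exists (const_mx (sup S)); split; last by move=> i j; rewrite !mxE.
apply: cvg_mx_coord => i j; rewrite ord1 mxE; apply/cvgrPdist_le => e /supS[s xs].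
by near=> t; apply: xs; near: t; apply: nbhs_pinfty_ge; exact: num_real.
Unshelve. all: by end_near. Qed.

End Contraction.

(** * Necessity of a spanning tree *)

Section Necessity.
Variables (R : realType) (n : nat) (tau_check taud : R).
Variables (upd : 'I_n -> nat -> R) (A : R -> 'M[R]_n).
Variables (N : 'I_n -> nat -> {set 'I_n}) (tau : 'I_n -> 'I_n -> nat -> R).
Hypothesis tau_check_gt0 : 0 < tau_check.
Hypothesis upd0 : forall i, upd i 0%N = 0.
Hypothesis upd_gap : forall i k, tau_check <= upd i k.+1 - upd i k.
Hypothesis N_pos : forall i k j, j \in N i k -> 0 < A (upd i k) i j.
Hypothesis tau_bounds : forall i k j, j \in N i k -> 0 <= tau i j k <= taud.
Hypothesis taud_ge0 : 0 <= taud.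
Implicit Type x : R -> 'cV[R]_n.

(** By induction along the update times: the target of an agent of S is a mean
    of values all equal to c. *)
Lemma isolated_constant x (S : {set 'I_n}) c : is_trajectory upd A N tau x ->
  (forall i k j, i \in S -> j \in N i k -> j \in S) ->
  (forall t i, - taud <= t <= 0 -> i \in S -> x t i 0 = c) ->
  forall t i, - taud <= t -> i \in S -> x t i 0 = c.
Proof.
move=> trx SN x0; apply: (event_ind tau_check_gt0 upd0 upd_gap) => [t t0 i tt iS|].
  by apply: x0 => //; rewrite tt.
move=> t t0 IH i _ iS.
have [k /andP[kt tk]] := update_interval tau_check_gt0 upd0 upd_gap i t0.
have u0 := upd_ge0 tau_check_gt0 upd0 upd_gap i k.
have tau0 := taud_ge0.
have past s j : - taud <= s -> s <= upd i k -> j \in S -> x s j 0 = c.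
  by move=> ls su jS; apply: (IH i k).
have xk : x (upd i k) i 0 = c by apply: past => //; lra.
rewrite (trx i k t); last by rewrite ltW.
have -> : target upd A N tau x i k = x (upd i k) i 0.
  rewrite xk /target xk; case: eqP => // /eqP Nk.
  rewrite -[RHS]mul1r -(sum_weight N_pos Nk) mulr_suml; apply: eq_bigr => j jN.
  have /andP[d0 dd] := tau_bounds jN.
  by rewrite past //; [lra|lra|exact: SN jN].
by rewrite relax_const.
Qed.

Lemma consensus_spanning_tree (E : {set 'I_n * 'I_n}) : (0 < n)%N ->
  (forall i k j, j \in N i k -> (j, i) \in E) ->
  solves_consensus upd A N tau taud -> contains_spanning_tree E.
Proof.
move=> n_gt0 NE cons; apply: contrapT => notree.
have [P [Q [v [w [PE QE vP wQ PQ]]]]] := disjoint_source_closed (Ordinal n_gt0) notree.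
pose phi (t : R) : 'cV[R]_n := \col_i (i \in Q)%:R.
have [[x sol] /(_ x sol)[xs [xcvg xs_eq]]] := cons phi.
have trx := solution_trajectory tau_check_gt0 upd0 upd_gap N_pos sol.
have [x0 _ _ _] := sol.
have const S c : source_closed E S -> (forall i, i \in S -> (i \in Q)%:R = c) ->
    forall i, i \in S -> xs i 0 = c.
  move=> SE Sc i iS.
  have xc t j : - taud <= t -> j \in S -> x t j 0 = c.
    apply: isolated_constant => // [l k h lS hN|u l u0 lS].
      exact: SE (NE _ _ _ hN) lS.
    by rewrite x0 // mxE Sc.
  have xi : (x t i 0 @[t --> +oo] --> xs i 0)%classic.
    apply: (@cvg_comp _ _ _ x (fun M : 'cV[R]_n => M i 0) _ _ _ xcvg).
    exact: coord_continuous.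
  apply: (cvg_unique (@norm_hausdorff _ R^o) xi).
  apply: cvg_near_cst; apply: filterS (nbhs_pinfty_ge (num_real (- taud))) => t tt.
  exact: xc.
have xv : xs v 0 = 0.
  apply: (const P) => // i iP.
  by have [iQ|//] := boolP (i \in Q); case: (PQ i iP iQ).
have xw : xs w 0 = 1 by apply: (const Q) => // i ->.
by have /eqP := xs_eq w v; rewrite xv xw oner_eq0.
Qed.

End Necessity.

Theorem theorem3 (R : realType) (n : nat) (n_gt0 : (0 < n)%N)
  (tau_check tau_hat a_check a_hat : R) (K : nat)
  (upd : 'I_n -> nat -> R)
  (A : R -> 'M[R]_n)
  (N : 'I_n -> nat -> {set 'I_n})
  (tau : 'I_n -> 'I_n -> nat -> R)
  (tau_check_gt0 : 0 < tau_check)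
  (upd0 : forall i, upd i 0%N = 0)
  (upd_step : forall i k, tau_check <= upd i k.+1 - upd i k <= tau_hat)
  (a_check_gt0 : 0 < a_check)
  (a_check_le_hat : a_check <= a_hat)
  (A_ge0 : forall (t : R) i j, 0 <= t -> 0 <= A t i j)
  (A_bounds : forall (t : R) i j, 0 <= t -> A t i j != 0 ->
     a_check <= A t i j <= a_hat)
  (N_sub : forall i k j, j \in N i k -> j != i /\ 0 < A (upd i k) i j)
  (tau_bounds : forall i k j, j \in N i k ->
     0 <= tau i j k <= K%:R * tau_check) :
  ((exists T : R, 0 <= T /\
      forall t0 : R, 0 <= t0 ->
        contains_spanning_tree (union_graph0 upd N t0 (t0 + T))) ->
   solves_consensus upd A N tau (K%:R * tau_check))
  /\
  ((forall s t : R, 0 <= s -> 0 <= t -> same_weighted_graph (A s) (A t)) ->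
   solves_consensus upd A N tau (K%:R * tau_check) ->
   forall t : R, 0 <= t -> contains_spanning_tree (graph_of_mx (A t))).
Proof.
have upd_gap i k : tau_check <= upd i k.+1 - upd i k by have /andP[] := upd_step i k.
have N_pos i k j : j \in N i k -> 0 < A (upd i k) i j by case/N_sub.
have upd_ge i k : 0 <= upd i k := upd_ge0 tau_check_gt0 upd0 upd_gap i k.
have taud_ge0 : 0 <= K%:R * tau_check by rewrite mulr_ge0 // ltW.
split=> [[T [T_ge0 tree]]|same cons t t_ge0]; last first.
  apply: (consensus_spanning_tree tau_check_gt0 upd0 upd_gap N_pos tau_bounds
    taud_ge0 n_gt0 _ cons) => i k j /N_pos Aij.
  by have [-> _] := same t (upd i k) t_ge0 (upd_ge i k); rewrite inE.
have tau_hat_ge0 : 0 <= tau_hat.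
  have /andP[lo hi] := upd_step (Ordinal n_gt0) 0%N.
  exact: le_trans (ltW tau_check_gt0) (le_trans lo hi).
have tau_ge0 i k j : j \in N i k -> 0 <= tau i j k by case/tau_bounds/andP.
have a_hat_gt0 : 0 < a_hat by exact: lt_le_trans a_check_le_hat.
have A_in i k j : j \in N i k -> a_check <= A (upd i k) i j <= a_hat.
  by move=> /N_pos Aij; apply: A_bounds => //; rewrite gt_eqF.
(* A sum of at most n weights, each at most a_hat, is the worst denominator. *)
pose alpha := a_check / (n%:R * a_hat).
have na_gt0 : 0 < n%:R * a_hat by rewrite mulr_gt0 // ltr0n.
have alpha_gt0 : 0 < alpha by rewrite divr_gt0.
have alpha_le1 : alpha <= 1.
  rewrite ler_pdivrMr // mul1r (le_trans a_check_le_hat) //.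
  by rewrite ler_peMl ?(ltW a_hat_gt0) // ler1n.
have weight_ge i k j : j \in N i k -> alpha <= weight upd A N i k j.
  move=> jN; have /andP[lo _] := A_in i k j jN.
  have sum_gt0 : 0 < \sum_(l in N i k) A (upd i k) i l.
    by apply: (weight_sum_gt0 N_pos); apply/set0Pn; exists j.
  rewrite /alpha /weight; apply: ler_pM => //.
  - exact: ltW.
  - by rewrite invr_ge0 ltW.
  rewrite lef_pV2 //.
  apply: (@le_trans _ _ (\sum_(l in N i k) a_hat)).
    by apply: ler_sum => l /A_in/andP[].
  rewrite sumr_const -[X in X <= _]mulr_natl ler_wpM2r ?(ltW a_hat_gt0) //.
  by rewrite ler_nat -[leqRHS]card_ord max_card.
move=> phi; split; first exact: solution_exists tau_check_gt0 upd0 upd_gap N_pos tau_ge0 _.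
move=> x /(solution_trajectory tau_check_gt0 upd0 upd_gap N_pos).
exact: (trajectory_consensus tau_check_gt0 upd0 upd_step N_pos tau_bounds
  tau_hat_ge0 taud_ge0 alpha_gt0 alpha_le1 weight_ge T_ge0 n_gt0 tree).
Qed.
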